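(* Let $\boldsymbol{x}$ be a real-valued random variable with some (arbitrary) distribution $f$. Let $\boldsymbol{x}^{[1]},\dots,\boldsymbol{x}^{[N_s]}$ be samples drawn independently from the distribution $f$, for some $N_s\ge 2$, with $\boldsymbol{x}$ independent of these samples. Let $$\hat{\mathbb{E}}[\boldsymbol{x}]=\frac{1}{N_s}\sum_{i=1}^{N_s}\boldsymbol{x}^{[i]},\qquad \hat{\mathrm{Std}}(\boldsymbol{x})=\sqrt{\frac{1}{N_s}\sum_{i=1}^{N_s}\left(\boldsymbol{x}^{[i]}-\hat{\mathbb{E}}[\boldsymbol{x}]\right)^2}$$ be the sample mean and sample standard deviation, and suppose $\hat{\mathrm{Std}}(\boldsymbol{x})>0$ almost surely. Then for any $\lambda>0$, $$\mathbb{P}\left(\boldsymbol{x}-\hat{\mathbb{E}}[\boldsymbol{x}]\ge \lambda\,\hat{\mathrm{Std}}(\boldsymbol{x})\right)\le \frac{(\sqrt{N_s+1}+\lambda)^2}{\lambda^2N_s+(\sqrt{N_s+1}+\lambda)^2}.$$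
   Context: The probability $\mathbb{P}$ is taken jointly over $\boldsymbol{x}$ and the samples $\boldsymbol{x}^{[1]},\dots,\boldsymbol{x}^{[N_s]}$, so $\hat{\mathbb{E}}[\boldsymbol{x}]$ and $\hat{\mathrm{Std}}(\boldsymbol{x})$ are random variables. No moments of the distribution $f$ are assumed to exist. The sample standard deviation uses the normalization $1/N_s$ (no Bessel correction). *)

(* Defs.v *)
From HB Require Import structures.
From mathcomp Require Import all_boot all_order all_algebra.
From mathcomp Require Import all_classical all_reals all_analysis.

Set Implicit Arguments.
Unset Strict Implicit.
Unset Printing Implicit Defensive.

Import Order.TTheory GRing.Theory Num.Theory.
Import numFieldNormedType.Exports.

Local Open Scope classical_set_scope.
Local Open Scope ring_scope.

(* The equality is required on measurable sets only: a measure is a function on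
   all of [set R], whose values off the sigma-algebra carry no meaning. *)
Definition has_law (d : measure_display) (T : measurableType d) (R : realType)
    (P : probability T R) (X : {RV P >-> R})
    (f : probability R R) : Prop :=
  forall A : set R, measurable A -> distribution P X A = f A.

Definition mutually_independent (d : measure_display) (T : measurableType d)
    (R : realType) (P : probability T R) (I : finType)
    (X : I -> {RV P >-> R}) : Prop :=
  forall (J : {set I}) (A : I -> set R),
    (forall i, i \in J -> measurable (A i)) ->
    P (\bigcap_(i in [set` J]) (X i @^-1` A i)) =
    (\prod_(i in J) P (X i @^-1` A i))%E.

(* Independence of [Y] from the whole family [X], i.e. of [Y] from the
   sigma-algebra generated by all the [X i] (not merely from each [X i]). *)
Definition independent_of_family (d : measure_display) (T : measurableType d)
    (R : realType) (P : probability T R) (n : nat)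
    (Y : {RV P >-> R}) (X : 'I_n -> {RV P >-> R}) : Prop :=
  forall (A : set R) (B : set T),
    measurable A ->
    g_sigma_preimage (fun i => X i : T -> R) B ->
    P (Y @^-1` A `&` B) = (P (Y @^-1` A) * P B)%E.

Definition sample_mean (T : Type) (R : realType) (n : nat)
    (X : 'I_n -> T -> R) (w : T) : R :=
  n%:R^-1 * \sum_(i < n) X i w.

(* Normalized by [1/n]: no Bessel correction. *)
Definition sample_std (T : Type) (R : realType) (n : nat)
    (X : 'I_n -> T -> R) (w : T) : R :=
  Num.sqrt (n%:R^-1 * \sum_(i < n) (X i w - sample_mean X w) ^+ 2).

(* Main.v *)
(** Put x in front of the samples to get n = Ns + 1 i.i.d. variables
    z_0, ..., z_Ns.  They are exchangeable, so the probability that z_0 lies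
    lambda sample deviations above the mean of the others is the expected
    fraction of indices i such that z_i does so with respect to the others.
    In terms of the mean M and the variance V of all n values, the condition on
    z_i implies z_i >= M and (z_i - M)^2 >= c V with
    c = lambda^2 Ns / (n + lambda^2).  By the one-sided Chebyshev (Cantelli)
    inequality for the empirical distribution, a fraction at most 1 / (1 + c)
    of the indices qualifies, and this is below the stated bound since
    n + lambda^2 <= (sqrt n + lambda)^2. *)
Require Import Defs.
From HB Require Import structures.
From mathcomp Require Import all_boot all_order all_algebra perm.
From mathcomp Require Import all_classical all_reals all_analysis.
From mathcomp Require Import measurable_realfun ring lra.

Import Order.TTheory GRing.Theory Num.Theory.
Import numFieldNormedType.Exports.

Local Open Scope classical_set_scope.
Local Open Scope ring_scope.

(** * Deterministic inequalities for finite samples *)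

Lemma sum_sqr_subr (R : realFieldType) (I : finType) (y : I -> R) (m : R) :
  \sum_i (y i - m) ^+ 2 =
  \sum_i y i ^+ 2 - 2 * m * \sum_i y i + #|I|%:R * m ^+ 2.
Proof.
transitivity (\sum_i (y i ^+ 2 - 2 * m * y i + m ^+ 2)).
  by apply: eq_bigr => i _; ring.
by rewrite big_split/= sumrB -mulr_sumr sumr_const -[X in _ + X = _]mulr_natl.
Qed.

Lemma sum_sample_mean (T : Type) (R : realType) (n : nat) (X : 'I_n -> T -> R)
  (w : T) : (0 < n)%N -> \sum_i X i w = n%:R * sample_mean X w.
Proof.
by move=> n0; rewrite /sample_mean mulrA divff ?mul1r// pnatr_eq0 -lt0n.
Qed.

Lemma sum_sqr_sample_std (T : Type) (R : realType) (n : nat)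
  (X : 'I_n -> T -> R) (w : T) : (0 < n)%N ->
  \sum_i X i w ^+ 2 = n%:R * (sample_std X w ^+ 2 + sample_mean X w ^+ 2).
Proof.
move=> n0; have n_neq0 : n%:R != 0 :> R by rewrite pnatr_eq0 -lt0n.
rewrite /sample_std sqr_sqrtr; last first.
  by rewrite mulr_ge0 ?invr_ge0// sumr_ge0// => i _; rewrite sqr_ge0.
by rewrite sum_sqr_subr card_ord sum_sample_mean//; field.
Qed.

(** Cantelli's inequality for the uniform law on [I], with threshold [k = sqrt (c * V)]. The squares
    of [V + k * (y i - M)] sum to [#|I| * V^2 * (1 + c)], and each counted index contributes at
    least [(V * (1 + c))^2]. *)
Lemma card_upper_deviation (R : realType) (I : finType) (y : I -> R)
    (c M V : R) :
  0 <= c -> 0 < V -> \sum_i y i = #|I|%:R * M ->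
  \sum_i y i ^+ 2 = #|I|%:R * (V + M ^+ 2) ->
  #|[pred i | (M <= y i) && (c * V <= (y i - M) ^+ 2)]|%:R * (1 + c)
    <= #|I|%:R.
Proof.
move=> c0 V0 sumy sumy2; set S := [pred i | _].
pose k := Num.sqrt (c * V).
have k2 : k ^+ 2 = c * V by rewrite sqr_sqrtr// mulr_ge0// ltW.
have k0 : 0 <= k by rewrite sqrtr_ge0.
(* The quadratic test function of the one-sided Chebyshev inequality. *)
have sumD : \sum_i (V + k * (y i - M)) ^+ 2 = #|I|%:R * V ^+ 2 * (1 + c).
  transitivity (\sum_i ((V - k * M) ^+ 2 + 2 * (V - k * M) * k * y i
                        + k ^+ 2 * y i ^+ 2)).
    by apply: eq_bigr => i _; ring.
  rewrite !big_split/= -!mulr_sumr sumy sumy2 sumr_const -mulr_natl.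
  by ring: k2.
have leS : #|S|%:R * (V * (1 + c)) ^+ 2 <= \sum_i (V + k * (y i - M)) ^+ 2.
  rewrite mulr_natl -sumr_const.
  rewrite [leRHS](bigID S)/= ler_wpDr ?sumr_ge0//.
    by move=> i _; exact: sqr_ge0.
  apply: ler_sum => i /andP[My cV].
  have ky : k <= y i - M.
    by rewrite -(@ler_pXn2r _ 2) ?nnegrE ?subr_ge0// k2.
  have Vc : V * (1 + c) <= V + k * (y i - M).
    by rewrite mulrDr mulr1 lerD2l mulrC -k2 expr2 ler_wpM2l.
  have V1c0 : 0 <= V * (1 + c) by rewrite mulr_ge0 ?addr_ge0// ltW.
  by rewrite ler_pXn2r ?nnegrE// (le_trans V1c0).
have V1c : 0 < V ^+ 2 * (1 + c) by rewrite mulr_gt0 ?exprn_gt0//; lra.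
rewrite -(ler_pM2r V1c) [leRHS]mulrA -sumD (le_trans _ leS)// le_eqVlt.
by apply/orP; left; apply/eqP; ring.
Qed.

(** Adjoining [a] to [N] values of mean [m] and deviation [s] gives [a - M = N/(N+1) * (a - m)] and
    [V = N/(N+1) * s^2 + N/(N+1)^2 * (a - m)^2]. Bounding [s] by [(a - m) / lambda] then compares
    [V] with [(a - M)^2]. *)
Lemma leave_one_out_deviation (T : Type) (R : realType) (N : nat)
    (X : 'I_N -> T -> R) (w : T) (a lambda M V : R) :
  (0 < N)%N -> 0 < lambda -> 0 < sample_std X w ->
  lambda * sample_std X w <= a - sample_mean X w ->
  a + \sum_i X i w = N.+1%:R * M ->
  a ^+ 2 + \sum_i X i w ^+ 2 = N.+1%:R * (V + M ^+ 2) ->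
  [/\ 0 < V, M <= a &
    lambda ^+ 2 * N%:R / (N.+1%:R + lambda ^+ 2) * V <= (a - M) ^+ 2].
Proof.
move=> N0 l0; rewrite sum_sqr_sample_std// sum_sample_mean//.
have : 0 < N%:R :> R by rewrite ltr0n.
rewrite -natr1; set s := sample_std _ _; set m := sample_mean _ _.
move: (N%:R) => n n0 s0 lsa eM eV.
have n1 : n + 1 != 0 by lra.
have ls0 : 0 < lambda * s by rewrite mulr_gt0.
have EM : M = (a + n * m) / (n + 1) by rewrite eM; field.
have EV : V = n / (n + 1) * s ^+ 2 + n / (n + 1) ^+ 2 * (a - m) ^+ 2.
  have -> : V = (a ^+ 2 + n * (s ^+ 2 + m ^+ 2)) / (n + 1) - M ^+ 2.
    by rewrite eV; field.
  by rewrite EM; field.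
have aM : a - M = n / (n + 1) * (a - m) by rewrite EM; field.
have q0 : 0 < n / (n + 1) by rewrite divr_gt0//; lra.
split.
- rewrite EV ltr_pwDl//; first by rewrite mulr_gt0// exprn_gt0.
  by rewrite mulr_ge0 ?sqr_ge0// divr_ge0 ?sqr_ge0// ltW.
- by rewrite -subr_ge0 aM mulr_ge0//; lra.
- have D0 : 0 < n + 1 + lambda ^+ 2 by rewrite addr_gt0 ?exprn_gt0//; lra.
  rewrite mulrAC ler_pdivrMr// aM EV -subr_ge0.
  (* With the denominator cleared, the gap is a nonnegative multiple of the gap in the assumed
     deviation. *)
  have -> : (n / (n + 1) * (a - m)) ^+ 2 * (n + 1 + lambda ^+ 2) -
      lambda ^+ 2 * n * (n / (n + 1) * s ^+ 2 + n / (n + 1) ^+ 2 * (a - m) ^+ 2)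
    = n ^+ 2 / (n + 1) * ((a - m) ^+ 2 - (lambda * s) ^+ 2) by field.
  apply: mulr_ge0; first by rewrite divr_ge0 ?sqr_ge0//; lra.
  by rewrite subr_ge0 ler_pXn2r ?nnegrE//; lra.
Qed.

(** * Laws of tuples, and expected counts of events *)

Lemma eq_prob_boxes d (T : measurableType d) (R : realType)
    (P : probability T R) n (U V : T -> n.-tuple R) :
  measurable_fun setT U -> measurable_fun setT V ->
  (forall A : 'I_n -> set R, (forall i, measurable (A i)) ->
    P [set w | forall i, A i (tnth (U w) i)] =
    P [set w | forall i, A i (tnth (V w) i)]) ->
  forall E, measurable E -> P (U @^-1` E) = P (V @^-1` E).
Proof.
move=> mU mV boxE E mE.
pose box (A : 'I_n -> set R) := [set t : n.-tuple R | forall i, A i (tnth t i)].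
pose G := [set box A | A in [set A | forall i, measurable (A i)]].
(* Boxes form a pi-system. They generate the sigma-algebra of tuples, since a coordinate cylinder is
   a box whose other sides are full. *)
have mG : measurable = <<s G >>.
  apply/seteqP; split.
    apply: smallest_sub; first exact: smallest_sigma_algebra.
    rewrite -bigcup_seq; apply: bigcup_sub => i _ _ [A mA <-].
    apply: sub_sigma_algebra.
    exists (fun j => if j == i then A else setT) => [j/=|].
      by case: ifP.
    apply/seteqP; split => [t /(_ i)|t [_ At] j] /=.
      by rewrite eqxx.
    by case: eqP => [->|].
  apply: smallest_sub; first exact: sigma_algebra_measurable.
  move=> _ [A mA <-].
  rewrite (_ : box A = \bigcap_(i in setT) ((@tnth _ R)^~ i @^-1` A i)).
    apply: fin_bigcap_measurable => // i _.
    by rewrite -[X in measurable X]setTI; exact: measurable_tnth.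
  by apply/seteqP; split => [t At i _|t At i]; exact: At.
pose u : {mfun T >-> n.-tuple R} := mfun_Sub (mem_set mU).
pose v : {mfun T >-> n.-tuple R} := mfun_Sub (mem_set mV).
apply: (measure_unique G (fun=> setT) mG _ _ _ (distribution P u)
  (distribution P v)) => //.
- move=> _ _ [A mA <-] [B mB <-]; exists (fun i => A i `&` B i).
    by move=> i; exact: measurableI.
  apply/seteqP; split => [t AB|t [At Bt] i].
    by split => i; have [] := AB i.
  by split; [exact: At|exact: Bt].
- by move=> _; exists (fun=> setT) => //; apply/seteqP.
- by rewrite bigcup_const//; exists 0%N.
- by move=> _ [A mA <-]; exact: boxE.
- by move=> _; rewrite (le_lt_trans (probability_le1 _ _)) ?ltry.
Qed.

(** Double counting: the sum of the probabilities is the expected number of events that occur, which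
    inherits the pointwise bound [K]. *)
Lemma card_le_prob d (T : measurableType d) (R : realType)
    (P : probability T R) (I : finType) (E : I -> set T) (p : \bar R) (K : R) :
  (forall i, measurable (E i)) -> (forall i, P (E i) = p) ->
  (forall w, #|[pred i | w \in E i]|%:R <= K) ->
  (#|I|%:R%:E * p <= K%:E)%E.
Proof.
move=> mE PE cardK.
have -> : (#|I|%:R%:E * p = \int[P]_w \sum_(i : I) (\1_(E i) w)%:E)%E.
  rewrite ge0_integral_sum//; last first.
    by move=> i; apply/measurable_EFinP.
  rewrite (eq_bigr (fun=> p)) => [|i _]; last first.
    by rewrite integral_indic// setIT; exact: PE.
  by rewrite sumr_const mule_natl cardT -cardE.
have -> : (K%:E = \int[P]_w K%:E)%E.
  rewrite integral_cst// -[LHS]mule1; congr (_ * _)%E.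
  exact/esym/probability_setT.
apply: ge0_le_integral => //.
- by move=> w _; apply: sume_ge0 => i _; rewrite lee_fin.
- by apply: emeasurable_sum => i; apply/measurable_EFinP.
move=> w _; rewrite sumEFin lee_fin (le_trans _ (cardK w))//.
rewrite -sum1_card natr_sum [leRHS]big_mkcond/=.
by apply: ler_sum => i _; rewrite indicE inE; case: ifP.
Qed.

(** * Exchangeability of independent, identically distributed variables *)

Section iid.
Context d (T : measurableType d) (R : realType) (P : probability T R)
  (f : probability R R).

(** [unlift ord0] places [x] at index 0 and the samples after it. Independence from the family
    splits off [x]; mutual independence over the full index set factors the rest. *)
Lemma independent_of_family_boxes n (x : {RV P >-> R})
    (xs : 'I_n -> {RV P >-> R}) (A : 'I_n.+1 -> set R) :
  has_law x f -> (forall i, has_law (xs i) f) ->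
  mutually_independent xs -> independent_of_family x xs ->
  (forall i, measurable (A i)) ->
  P [set w | forall i, A i (oapp xs x (unlift ord0 i) w)] =
    (\prod_i f (A i))%E.
Proof.
move=> lx lxs ixs ix mA.
pose B := \bigcap_(i in [set` [set: 'I_n]%SET]) (xs i @^-1` A (lift ord0 i)).
have -> : [set w | forall i, A i (oapp xs x (unlift ord0 i) w)] =
    x @^-1` A ord0 `&` B.
  apply/seteqP; split => [w Aw|w [A0 Bw] i].
    split; first by have := Aw ord0; rewrite unlift_none.
    by move=> i _; have := Aw (lift ord0 i); rewrite liftK.
  by case: unliftP => [j|] ->; [apply: Bw; rewrite /= inE|].
rewrite ix//; last first.
  rewrite /g_sigma_preimage; set G := (X in <<s X >>).
  (* The intersection is taken in the sigma-algebra generated by the samples, as independence from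
     the family demands, not in that of [T]. *)
  apply: (@fin_bigcap_measurable _ (g_sigma_algebraType G)) => // i _.
  apply: sub_sigma_algebra; rewrite /G -bigcup_seq.
  exists i; first by rewrite /= mem_index_enum.
  by exists (A (lift ord0 i)); rewrite ?setTI.
rewrite big_ord_recl [in LHS]ixs//; congr (_ * _)%E.
  exact: lx.
by apply: eq_big => [i|i _]; [rewrite inE|exact: lxs].
Qed.

Lemma iid_exchangeable n (z : 'I_n -> {RV P >-> R}) (s : 'S_n) :
  (forall A : 'I_n -> set R, (forall i, measurable (A i)) ->
    P [set w | forall i, A i (z i w)] = (\prod_i f (A i))%E) ->
  forall E : set (n.-tuple R), measurable E ->
  P ((fun w => [tuple z (s i) w | i < n]) @^-1` E) =
  P ((fun w => [tuple z i w | i < n]) @^-1` E).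
Proof.
move=> boxz.
have mz (r : 'S_n) : measurable_fun setT (fun w => [tuple z (r i) w | i < n]).
  apply/measurable_fun_tnthP => i.
  rewrite (_ : _ \o _ = z (r i)); first exact: measurable_funPT.
  by apply/funext => w /=; rewrite tnth_mktuple.
have {mz}[mzs mz] : measurable_fun setT (fun w => [tuple z (s i) w | i < n]) /\
    measurable_fun setT (fun w => [tuple z i w | i < n]).
  split; first exact: mz.
  apply: eq_measurable_fun (mz 1%g) => w _.
  by apply: eq_from_tnth => i; rewrite !tnth_mktuple perm1.
apply: eq_prob_boxes => // A mA.
(* Permuting the variables amounts to permuting the sides by the inverse, which leaves the product
   of the [f (A i)] unchanged. *)
transitivity (P [set w | forall i, A (s^-1%g i) (z i w)]).
  congr (P _); apply/seteqP; split => w Aw i.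
    by have := Aw (s^-1%g i); rewrite tnth_mktuple permKV.
  by have := Aw (s i); rewrite tnth_mktuple permK.
transitivity (P [set w | forall i, A i (z i w)]); last first.
  by congr (P _); apply/seteqP; split => w Aw i; have := Aw i;
    rewrite tnth_mktuple.
rewrite boxz// (boxz (fun i => A (s^-1%g i)))// (reindex_perm s)/=.
by apply: eq_bigr => i _; rewrite permK.
Qed.

End iid.

(** * Transfer and measurability of the sample statistics, and comparison of the two bounds *)

Lemma eq_sample_mean (T T' : Type) (R : realType) n (X : 'I_n -> T -> R)
    (Y : 'I_n -> T' -> R) w w' :
  (forall i, X i w = Y i w') -> sample_mean X w = sample_mean Y w'.
Proof.
by move=> XY; rewrite /sample_mean; congr (_ * _); apply: eq_bigr => i _.
Qed.

Lemma eq_sample_std (T T' : Type) (R : realType) n (X : 'I_n -> T -> R)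
    (Y : 'I_n -> T' -> R) w w' :
  (forall i, X i w = Y i w') -> sample_std X w = sample_std Y w'.
Proof.
move=> XY; rewrite /sample_std (eq_sample_mean _ _ _ _ _ _ _ _ XY).
by congr (Num.sqrt (_ * _)); apply: eq_bigr => i _; rewrite XY.
Qed.

(** The map [t / (k + t)] is nondecreasing for [k > 0]; the left side is its value at [n + l^2], and
    [(r + l)^2] exceeds that by [2 * r * l]. *)
Lemma outlier_frequency_le (R : realFieldType) (l m n r : R) :
  0 < l -> 0 < m -> 0 <= r -> r ^+ 2 = n ->
  (1 + l ^+ 2 * m / (n + l ^+ 2))^-1 <=
  (r + l) ^+ 2 / (l ^+ 2 * m + (r + l) ^+ 2).
Proof.
move=> l0 m0 r0 r2; have n0 : 0 <= n by rewrite -r2 sqr_ge0.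
have l2 : 0 < l ^+ 2 by rewrite exprn_gt0.
have k0 : 0 < l ^+ 2 * m by rewrite mulr_gt0.
have rl0 : 0 <= 2 * r * l by apply: mulr_ge0; [apply: mulr_ge0|exact: ltW].
have -> : (1 + l ^+ 2 * m / (n + l ^+ 2))^-1 =
    (n + l ^+ 2) / (l ^+ 2 * m + (n + l ^+ 2)).
  by field; apply/andP; split; lra.
have -> : (r + l) ^+ 2 = n + l ^+ 2 + 2 * r * l by ring: r2.
move: (l ^+ 2 * m) (2 * r * l) k0 rl0 => k q k0 q0.
rewrite ler_pdivrMr; last by lra.
rewrite mulrAC ler_pdivlMr; last by lra.
nra.
Qed.

Lemma measurable_sample_mean d (T : measurableType d) (R : realType) n
    (X : 'I_n -> T -> R) :
  (forall i, measurable_fun setT (X i)) ->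
  measurable_fun setT (sample_mean X).
Proof. by move=> mX; apply: measurable_funM => //; exact: measurable_sum. Qed.

Lemma measurable_sample_std d (T : measurableType d) (R : realType) n
    (X : 'I_n -> T -> R) :
  (forall i, measurable_fun setT (X i)) ->
  measurable_fun setT (sample_std X).
Proof.
move=> mX; apply: (@measurableT_comp _ _ _ _ _ _ (@Num.sqrt R)).
  by apply: continuous_measurable_fun; exact: sqrt_continuous.
apply: measurable_funM => //; apply: measurable_sum => i.
apply/measurable_funX/measurable_funB => //.
exact: measurable_sample_mean.
Qed.

(** * The outlier event and the number of outlying indices *)

Section outlier.
Context (R : realType) (N : nat) (lambda : R).

(* A positive deviation is required so that V > 0 above; by hypothesis this
   excludes only a null event. *)
Definition outlier : set (N.+1.-tuple R) :=
  let X (j : 'I_N) (t : N.+1.-tuple R) := tnth t (lift ord0 j) in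
  [set t | lambda * sample_std X t <= tnth t ord0 - sample_mean X t] `&`
  [set t | 0 < sample_std X t].

Lemma measurable_outlier : measurable outlier.
Proof.
rewrite /outlier /=; set X := (X in sample_std X).
have mX i : measurable_fun setT (X i) by exact: measurable_tnth.
have mstd := measurable_sample_std _ _ _ _ _ mX; have mmean := measurable_sample_mean _ _ _ _ _ mX.
apply: measurableI.
  rewrite -[X in measurable X]setTI; apply: measurable_fun_le => //.
    exact: measurable_funM.
  by apply: measurable_funB => //; exact: measurable_tnth.
have m0lt : measurable_fun setT (fun t => 0 < sample_std X t).
  by apply: measurable_fun_ltr.
by have := m0lt measurableT [set true]; rewrite setTI; exact.
Qed.

(** The transposition brings [y i] to the front and only rearranges the values, so one pooled mean
    [M] and variance [V] serve every [i]. *)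
Lemma card_outlier (y : 'I_N.+1 -> R) : (0 < N)%N -> 0 < lambda ->
  #|[pred i | [tuple y (tperm ord0 i j) | j < N.+1] \in outlier]|%:R *
    (1 + lambda ^+ 2 * N%:R / (N.+1%:R + lambda ^+ 2)) <= N.+1%:R.
Proof.
move=> N0 l0; set S := [pred i | _].
set c := lambda ^+ 2 * N%:R / _.
have c0 : 0 <= c.
  by apply: divr_ge0; [apply: mulr_ge0|apply: addr_ge0]; rewrite ?sqr_ge0.
have n0 : N.+1%:R != 0 :> R by rewrite pnatr_eq0.
pose M := (\sum_i y i) / N.+1%:R.
pose V := (\sum_i y i ^+ 2) / N.+1%:R - M ^+ 2.
have sumy : \sum_i y i = N.+1%:R * M by rewrite /M mulrCA divff ?mulr1.
have sumy2 : \sum_i y i ^+ 2 = N.+1%:R * (V + M ^+ 2).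
  by rewrite /V subrK mulrCA divff ?mulr1.
have outE i : i \in S -> [/\ 0 < V, M <= y i & c * V <= (y i - M) ^+ 2].
  rewrite !inE => -[/=]; set X := (X in sample_std X).
  rewrite tnth_mktuple tpermL => le_std std0.
  apply: leave_one_out_deviation _ _ _ _ _ _ _ _ _ N0 l0 std0 le_std _ _.
    rewrite -sumy (reindex_perm (tperm ord0 i))/= big_ord_recl tpermL.
    by congr (_ + _); apply: eq_bigr => j _; rewrite /X tnth_mktuple.
  rewrite -sumy2 (reindex_perm (tperm ord0 i))/= big_ord_recl tpermL.
  by congr (_ + _); apply: eq_bigr => j _; rewrite /X tnth_mktuple.
(* Positivity of [V] comes from any outlying index; without one the count is 0. *)
have [i0 i0S|S0] := pickP (mem S); last first.
  by rewrite (eq_card0 S0) mul0r ler0n.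
have [V0 _ _] := outE _ i0S.
have := @card_upper_deviation R 'I_N.+1 y c M V c0 V0.
rewrite card_ord => /(_ sumy sumy2); apply: le_trans.
rewrite ler_wpM2r ?addr_ge0// ler_nat; apply/subset_leq_card/fintype.subsetP => i iS.
by have [_ My cV] := outE _ iS; rewrite inE My.
Qed.

End outlier.

(** * From the counting bound to the probability bound *)

Theorem theorem1 (R : realType) (d : measure_display) (T : measurableType d)
    (P : probability T R) (f : probability R R)
    (x : {RV P >-> R}) (Ns : nat) (xs : 'I_Ns -> {RV P >-> R})
    (Ns_ge2 : (2 <= Ns)%N)
    (x_law : has_law x f)
    (xs_law : forall i : 'I_Ns, has_law (xs i) f)
    (xs_indep : mutually_independent xs)
    (x_indep_xs : independent_of_family x xs)
    (std_gt0 : {ae P, forall w, 0 < sample_std xs w})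
    (lambda : R) (lambda_gt0 : 0 < lambda) :
  (P [set w | (x w - sample_mean xs w >= lambda * sample_std xs w)%R] <=
   ((Num.sqrt (Ns.+1)%:R + lambda) ^+ 2 /
    (lambda ^+ 2 * Ns%:R + (Num.sqrt (Ns.+1)%:R + lambda) ^+ 2))%:E)%E.
Proof.
have Ns0 : (0 < Ns)%N by exact: leq_trans Ns_ge2.
pose z (i : 'I_Ns.+1) : {RV P >-> R} := oapp xs x (unlift ord0 i).
pose Z (s : 'S_Ns.+1) (w : T) := [tuple z (s i) w | i < Ns.+1].
(* [E i]: the value [z i] is an outlier relative to all the others. *)
pose E i := Z (tperm ord0 i) @^-1` outlier R Ns lambda.
pose p := P ((fun w => [tuple z i w | i < Ns.+1]) @^-1` outlier R Ns lambda).
have mO : measurable (outlier R Ns lambda : set (Ns.+1.-tuple R)).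
  exact: measurable_outlier.
have PE i : P (E i) = p.
  apply: (iid_exchangeable _ _ _ P f) mO => A mA.
  exact: (independent_of_family_boxes _ _ _ P f).
have mE i : measurable (E i).
  rewrite -[X in measurable X]setTI; apply: (_ : measurable_fun setT _) => //.
  apply/measurable_fun_tnthP => j; rewrite (_ : _ \o _ = z (tperm ord0 i j)).
    exact: measurable_funPT.
  by apply/funext => w /=; rewrite tnth_mktuple.
pose c : R := lambda ^+ 2 * Ns%:R / (Ns.+1%:R + lambda ^+ 2).
have c0 : 0 < 1 + c.
  rewrite ltr_wpDr//.
  by apply: divr_ge0; [apply: mulr_ge0|apply: addr_ge0]; rewrite ?sqr_ge0.
have cardE w : #|[pred i | w \in E i]|%:R <= Ns.+1%:R / (1 + c).
  rewrite ler_pdivlMr//.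
  exact: (card_outlier R Ns lambda (fun i => z i w) Ns0 lambda_gt0).
have := card_le_prob _ _ _ _ _ _ _ _ mE PE cardE; rewrite card_ord => le_p.
have le_event : (P [set w | (x w - sample_mean xs w >=
    lambda * sample_std xs w)%R] <= p)%E.
  have mxs i : measurable_fun setT (xs i : T -> R) by exact: measurable_funPT.
  have mstd := measurable_sample_std _ _ _ _ _ mxs.
  have mmean := measurable_sample_mean _ _ _ _ _ mxs.
  have mZ : measurable ((fun w => [tuple z i w | i < Ns.+1]) @^-1`
      outlier R Ns lambda).
    have := mE ord0; rewrite /E /Z tperm1.
    by under eq_fun do under eq_mktuple do rewrite perm1.
  (* [B] is a null set covering the points where the deviation fails to be positive; adjoining it to
     the outlier event costs no probability. *)
  have [B [mB B0 std_B]] := std_gt0.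
  rewrite /p -(measureU0 mZ mB B0); apply: le_measure; rewrite ?inE.
  - rewrite -[X in measurable X]setTI; apply: measurable_fun_le => //.
      exact: measurable_funM.
    by apply: measurable_funB => //; exact: measurable_funPT.
  - exact: measurableU.
  - move=> w /= le_std.
    pose t := [tuple z i w | i < Ns.+1].
    pose X (j : 'I_Ns) (u : Ns.+1.-tuple R) := tnth u (lift ord0 j).
    have xsE j : X j t = xs j w by rewrite /X tnth_mktuple /z liftK.
    have meanE : sample_mean X t = sample_mean xs w by exact: eq_sample_mean.
    have stdE : sample_std X t = sample_std xs w by exact: eq_sample_std.
    have tE : tnth t ord0 = x w by rewrite tnth_mktuple /z unlift_none.
    have [std0|/std_B] := pselect (0 < sample_std xs w); last by right.
    left; split; last by rewrite -stdE in std0.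
    by rewrite -tE -meanE -stdE in le_std.
apply: (le_trans le_event).
have {le_p} : (p <= ((1 + c)^-1)%:E)%E.
  by move: le_p; rewrite EFinM lee_pmul2l// lte_fin ltr0n.
move=> /le_trans; apply; rewrite lee_fin.
apply: outlier_frequency_le => //.
- by rewrite ltr0n.
- by rewrite sqr_sqrtr ?ler0n.
Qed.
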